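(* There is a function $\varepsilon:\mathbb{N}\to[0,\infty)$ with $\varepsilon(n)\to 0$ as $n\to\infty$ such that the following holds for every $n$. Let $D$ be a loopless multigraph on the vertex set $A\cup B$ of $K_{n,n}$. If \[ \Delta(D)\le (1-\varepsilon(n))\cdot\left(\frac{2n}{7}-\frac37\cdot \frac{e(D[A,B])}{n}\right), \] then $D$ is realizable in $K_{n,n}$.
   Context: $K_{n,n}$ is the complete bipartite graph with color classes $A=\{a_1,\dots,a_n\}$ and $B=\{b_1,\dots,b_n\}$. Given a simple graph $G$ and a loopless multigraph $D$ on the same vertex set, $D$ is realizable in $G$ if one can choose, for every edge $e\in E(D)$ (counted with multiplicity), a path $P(e)$ in $G$ joining the end-vertices of $e$, such that these paths are pairwise edge-disjoint. $\Delta(D)$ is the maximum degree of $D$ (counting multiplicities). $D[A,B]$ is the bipartite sub-multigraph of $D$ consisting of the edges of $D$ with one end in $A$ and the other in $B$, and $e(\cdot)$ denotes the number of edges counted with multiplicity. *)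

(* Defs.v *)
From mathcomp Require Import all_boot.

Set Implicit Arguments.
Unset Strict Implicit.
Unset Printing Implicit Defensive.

Record sgraph (V : finType) := SGraph {
  adj : rel V;
  adj_sym : symmetric adj;
  adj_irr : irreflexive adj }.

(* Edges form a type of their own, so parallel edges are distinct elements
   of [edge D] with the same pair of ends; [card_ends] excludes loops. *)
Record multigraph (V : finType) := MultiGraph {
  edge : finType;
  ends : edge -> {set V};
  card_ends : forall e, #|ends e| = 2 }.

Section Multigraph.
Variables (V : finType) (D : multigraph V).

Definition num_edges : nat := #|edge D|.

Definition degree (v : V) : nat := #|[set e : edge D | v \in ends e]|.

Definition max_degree : nat := \max_(v : V) degree v.

Definition crosses (X Y : {set V}) (e : edge D) : bool :=
  [exists x in X, exists y in Y, ends e == [set x; y]].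

(* D[X, Y] *)
Definition bip_sub (X Y : {set V}) : multigraph V :=
  @MultiGraph V {e : edge D | crosses X Y e}
    (fun e => ends (val e)) (fun e => card_ends (val e)).

End Multigraph.

(* The vertex sequence of the path is [phead :: ptail]. *)
Record gpath (V : finType) (G : sgraph V) := GPath {
  phead : V;
  ptail : seq V;
  gpath_adj : path (adj G) phead ptail;
  gpath_uniq : uniq (phead :: ptail) }.

Section Realizable.
Variables (V : finType) (G : sgraph V).

Definition plast (p : gpath G) : V := last (phead p) (ptail p).

Definition path_edges (p : gpath G) : seq {set V} :=
  pairmap (fun u v => [set u; v]) (phead p) (ptail p).

Definition realizable (D : multigraph V) : Prop :=
  exists P : edge D -> gpath G,
    (forall e, [set phead (P e); plast (P e)] = ends e) /\
    (forall e f, e != f -> [disjoint path_edges (P e) & path_edges (P f)]).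

End Realizable.

Section CompleteBipartite.
Variable n : nat.

(* a_i is [inl i] and b_i is [inr i]. *)
Definition Kvert : finType := ('I_n + 'I_n)%type.

Definition sideA : {set Kvert} := [set inl i | i : 'I_n].
Definition sideB : {set Kvert} := [set inr i | i : 'I_n].

Definition Kadj : rel Kvert := fun u v =>
  (u \in sideA) && (v \in sideB) || (u \in sideB) && (v \in sideA).

Lemma Kadj_sym : symmetric Kadj.
Proof. by move=> u v; rewrite /Kadj orbC [in LHS]andbC [X in _ || X]andbC. Qed.

Lemma Kadj_irr : irreflexive Kadj.
Proof.
move=> u; rewrite /Kadj andbC orbb.
by apply/negP => /andP[/imsetP[i _ ->] /imsetP[j _]].
Qed.

Definition Knn : sgraph Kvert := SGraph Kadj_sym Kadj_irr.

End CompleteBipartite.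

(* Main.v *)
Require Import Defs.
From mathcomp Require Import all_boot all_order all_algebra.
From mathcomp Require Import zify ring lra.
Set Implicit Arguments.
Unset Strict Implicit.
Unset Printing Implicit Defensive.
Import Order.TTheory GRing.Theory Num.Theory.

(** Send an edge inside A through a vertex of B, an edge inside B through a
    vertex of A, and a cross edge ab along a b' a' b, the vertex b' being chosen
    first. Choosing the vertices of B amounts to a proper edge coloring, with
    color set B, of the graph formed by D[A] and one pendant edge at a for each
    cross edge ab. Kempe changes make it balanced: up to O(sqrt n), every color
    b covers at most Delta vertices of A and is given to e(D[A,B])/n cross
    edges. What remains is a multigraph on B (the edges of D[B] and the edges
    b'b) of maximum degree at most Delta + e(D[A,B])/n + O(sqrt n), to be
    edge-colored from lists of size n - 2 Delta - O(sqrt n), the colors being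
    the vertices of A. The list version of Shannon's theorem does it, as lists
    of size 3/2 times the maximum degree suffice. *)

(** * Alternating 2-colorings of bipartite multigraphs *)

Lemma card_bigcup_le (I T : finType) (P : pred I) (F : I -> {set T}) :
  #|\bigcup_(i | P i) F i| <= \sum_(i | P i) #|F i|.
Proof.
elim/big_rec2: _ => [|i k B _ IH]; first by rewrite cards0.
by apply: leq_trans (leq_card_setU _ _) _; rewrite leq_add2l.
Qed.

(* No point x is in the (t o s)-orbit of s x, since otherwise s or t would have
   a fixed point; so s and t exchange these orbits in pairs. *)
Lemma fixfree_involutions_2coloring (T : finType) (s t : T -> T) :
  involutive s -> involutive t ->
  (forall x, s x != x) -> (forall x, t x != x) ->
  exists c : T -> bool,
    (forall x, c (s x) = ~~ c x) /\ (forall x, c (t x) = ~~ c x).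
Proof.
move=> sK tK sN tN; pose h x := t (s x).
have h_inj : injective h by move=> x y /(inv_inj tK)/(inv_inj sK).
(* Conjugation by [s] inverts [h], so its powers satisfy h^i s h^i = s. *)
have hsh i x : iter i h (s (iter i h x)) = s x.
  have hs z : h (s (h z)) = s z by rewrite /h sK tK.
  by elim: i x => [//|i IH] x; rewrite iterSr iterS hs IH.
have it_inj i : injective (iter i h) by elim: i => //= i IH x y /h_inj/IH.
have sep x : ~~ fconnect h x (s x).
  apply/negP => /iter_findex; move: (findex _ _ _) => i Hi.
  (* Suppose h^i x = s x and cut i into halves: for i = 2j the point h^j x is fixed by [s], for i =
     2j + 1 the point h^(j+1) x is fixed by [t]. *)
  have := odd_double_half i; set j := i./2; rewrite -addnn; case: (odd i) => /= Ei.
    have := hsh j.+1 x; rewrite -Hi -Ei add1n -addSn iterD => /it_inj sy.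
    move: sy; rewrite iterS; set z := iter j h x => sy.
    have sz : s z = h z by rewrite -{1}sy sK.
    by have := tN (h z); rewrite -{1}sz eqxx.
  have := hsh j x; rewrite -Hi -Ei add0n iterD => /it_inj sy.
  by have := sN (iter j h x); rewrite sy eqxx.
(* Orbits are compared through the ranks of their representatives; the color of x will tell whether
   its orbit precedes that of [s x]. *)
pose rk x := enum_rank (froot h x).
have rkE x y : fconnect h x y -> rk x = rk y.
  by move=> /(fingraph.rootP (fconnect_sym h_inj)) xy; rewrite /rk xy.
have rkN x : rk x != rk (s x).
  by apply: contra (sep x) => /eqP/enum_rank_inj/(fingraph.rootP (fconnect_sym h_inj)).
have rkt x : rk (t x) = rk (s x).
  by symmetry; apply: rkE; rewrite -[in X in fconnect _ _ X](sK x); exact: fconnect1.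
have rkst x : rk (s (t x)) = rk x.
  by apply: rkE; rewrite -[X in fconnect _ _ X]tK -[in X in fconnect _ _ X](sK (t x)); exact: fconnect1.
have ltN x : (rk (s x) < rk x) = ~~ (rk x < rk (s x)).
  by rewrite -leqNgt ltn_neqAle eq_sym rkN.
exists (fun x => rk x < rk (s x)); split=> x; first by rewrite sK ltN.
by rewrite rkt rkst ltN.
Qed.

Lemma involutions_2coloring (T : finType) (s t : T -> T) :
  involutive s -> involutive t ->
  exists c : T -> bool, (forall x, s x != x -> c (s x) = ~~ c x) /\
                        (forall x, t x != x -> c (t x) = ~~ c x).
Proof.
(* Gluing two copies of T along the fixed points removes them. *)
move=> sK tK.
pose lft (u : T -> T) (z : T * bool) :=
  if u z.1 == z.1 then (z.1, ~~ z.2) else (u z.1, z.2).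
have lftK u : involutive u -> involutive (lft u).
  move=> uK [x i]; rewrite /lft /=; have [E|N] := eqVneq (u x) x.
    by rewrite /= E eqxx negbK.
  by rewrite /= uK eq_sym (negPf N).
have lftN u z : lft u z != z.
  case: z => x i; rewrite /lft /=; have [E|N] := eqVneq (u x) x.
    by rewrite xpair_eqE eqxx; case: i.
  by rewrite xpair_eqE (negPf N).
have [c [cs ct]] := fixfree_involutions_2coloring (lftK s sK) (lftK t tK)
  (lftN s) (lftN t).
exists (fun x => c (x, false)); split=> x /negPf N.
  by have := cs (x, false); rewrite /lft /= N.
by have := ct (x, false); rewrite /lft /= N.
Qed.

(** The involution exchanges the first two elements of S in each fiber of [x] and fixes all others.
    One pair per fiber is enough to make both colors occur there. *)
Lemma fiber_pairing (E : finType) (V : eqType) (x : E -> V) (S : {set E}) :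
  exists s : E -> E, involutive s /\
    forall v, 1 < #|[set e in S | x e == v]| ->
      exists e, [/\ e \in S, x e = v, s e \in S, x (s e) = v & s e != e].
Proof.
pose F v := [set e in S | x e == v].
pose s e := if enum (F (x e)) is a :: b :: _ then
  (if e == a then b else if e == b then a else e) else e.
exists s; split=> [e|v].
  have [E0|[a [b [l El]]]] : s e = e \/ exists a b l, enum (F (x e)) = a :: b :: l.
  - rewrite /s; case: (enum _) => [|a [|b l]]; [by left|by left|right].
    by exists a, b, l.
  - by rewrite !E0.
  have xa : x a = x e.
    have : a \in enum (F (x e)) by rewrite El inE eqxx.
    by rewrite mem_enum inE => /andP[_ /eqP].
  have xb : x b = x e.
    have : b \in enum (F (x e)) by rewrite El !inE eqxx orbT.
    by rewrite mem_enum inE => /andP[_ /eqP].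
  have ab : b != a.
    have := enum_uniq (F (x e)); rewrite El /= inE negb_or -andbA => /andP[+ _].
    by rewrite eq_sym.
  rewrite [s e]/s El; have [->|ea] := eqVneq e a.
    by rewrite /s xb El (negPf ab) eqxx.
  have [->|eb] := eqVneq e b; first by rewrite /s xa El eqxx.
  by rewrite /s El (negPf ea) (negPf eb).
rewrite cardE -/(F v); case El: (enum _) => [|a [|b l]] //= _.
have : a \in enum (F v) by rewrite El inE eqxx.
rewrite mem_enum inE => /andP[aS /eqP xa].
have : b \in enum (F v) by rewrite El !inE eqxx orbT.
rewrite mem_enum inE => /andP[bS /eqP xb].
have ab : b != a.
  have := enum_uniq (F v); rewrite El /= inE negb_or -andbA => /andP[+ _].
  by rewrite eq_sym.
by exists a; rewrite /s xa El eqxx.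
Qed.

(** Pair two edges of S at each vertex of degree at least 2, separately on the two sides. A
    2-coloring that changes along both pairings shows both colors at each such vertex. *)
Lemma bipartite_2coloring (E : finType) (X Y : eqType) (x : E -> X) (y : E -> Y)
    (S : {set E}) :
  exists c : E -> bool,
    (forall v b, 1 < #|[set e in S | x e == v]| ->
       exists e, [/\ e \in S, x e = v & c e = b]) /\
    (forall v b, 1 < #|[set e in S | y e == v]| ->
       exists e, [/\ e \in S, y e = v & c e = b]).
Proof.
have [s [sK sP]] := fiber_pairing x S; have [t [tK tP]] := fiber_pairing y S.
have [c [cs ct]] := involutions_2coloring sK tK.
exists c; split=> v b.
  move/sP=> [e [eS xe seS xse ne]].
  have [cb|cb] := eqVneq (c e) b; first by exists e.
  by exists (s e); rewrite cs //; split=> //; move: cb; case: (c e); case: b.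
move/tP=> [e [eS xe seS xse ne]].
have [cb|cb] := eqVneq (c e) b; first by exists e.
by exists (t e); rewrite ct //; split=> //; move: cb; case: (c e); case: b.
Qed.

(** * Stable matchings, Galvin's argument and greedy coloring *)

(* A stable matching (Gale and Shapley): x prefers edges of large rank, y edges
   of small rank. *)
Lemma kernel_exists (E X Y : finType) (x : E -> X) (y : E -> Y) (r : E -> nat)
    (S : {set E}) : injective r ->
  exists M : {set E}, [/\ M \subset S,
    forall e f, e \in M -> f \in M -> e != f -> x e != x f /\ y e != y f &
    forall e, e \in S -> e \notin M -> exists2 f, f \in M &
      (x f == x e) && (r e < r f) || (y f == y e) && (r f < r e)].
Proof.
move=> r_inj; move: {2}#|S| (erefl #|S|) => N; elim: N S => [|N IH] S SN.
  move/eqP: SN; rewrite cards_eq0 => /eqP->; exists set0; split=> // e.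
  - by move=> f; rewrite inE.
  - by rewrite inE.
pose top e := [forall f in S, (x f == x e) ==> (r f <= r e)].
have topP e f : top e -> f \in S -> x f = x e -> r f <= r e.
  by move=> /forall_inP te fS /eqP xfe; apply: (implyP (te f fS)).
have topE e : e \in S -> exists f, [/\ f \in S, top f & x f = x e].
  move=> eS; have Pe : (e \in S) && (x e == x e) by rewrite eS eqxx.
  case: (@arg_maxnP _ e (fun f => (f \in S) && (x f == x e)) r Pe) => f /andP[fS /eqP xf] fmax.
  exists f; split=> //; apply/forall_inP => g gS; apply/implyP => /eqP xg.
  by apply: fmax; rewrite gS xg xf /=.
(* When two first choices clash at a vertex of Y, the one of larger rank, [f], is dropped. In a
   kernel M of the rest, either [e] is in M and absorbs [f], or [e], being a first choice, is
   absorbed at its Y end by an edge that absorbs [f] too. *)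
have [/existsP[e /existsP[f /and5P[eS fS te tf /andP[yef ref]]]]|nodom] :=
  boolP [exists e, exists f, [&& e \in S, f \in S, top e, top f, y e == y f & r e < r f]].
  have S'N : #|S :\ f| = N by move: SN; rewrite (cardsD1 f) fS => -[].
  have [M [MS Mind Mabs]] := IH _ S'N; exists M; split=> //.
    exact: subset_trans MS (subsetDl _ _).
  move=> g gS gM; have [gf|gf] := eqVneq g f; last by apply: Mabs; rewrite ?inE ?gf.
  have eS' : e \in S :\ f.
    by rewrite !inE eS andbT; apply: contraTneq ref => ->; rewrite ltnn.
  have [eM|eM] := boolP (e \in M).
    by exists e => //; rewrite gf yef ref orbT.
  have [h hM /orP[/andP[/eqP xhe reh]|/andP[/eqP yhe rhe]]] := Mabs e eS' eM.
    have hS : h \in S by move/(subsetP MS): hM; rewrite inE => /andP[].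
    by have := topP _ _ te hS xhe; rewrite leqNgt reh.
  exists h => //; rewrite gf yhe yef (ltn_trans rhe ref) orbT //.
(* Without clashes, the first choices themselves form the kernel. *)
exists [set e in S | top e]; split.
- by apply/subsetP => e; rewrite inE => /andP[].
- move=> e f; rewrite !inE => /andP[eS te] /andP[fS tf] ef.
  have ref : r e != r f by rewrite (inj_eq r_inj).
  split; apply/eqP => E'.
    by move: ref; rewrite eqn_leq (topP _ _ tf eS E') (topP _ _ te fS (esym E')).
  case/negP: nodom; move: ref; rewrite neq_ltn => /orP[ref|ref].
    by apply/existsP; exists e; apply/existsP; exists f; rewrite eS fS te tf E' eqxx.
  by apply/existsP; exists f; apply/existsP; exists e; rewrite eS fS te tf E' eqxx.
- move=> e eS; rewrite inE eS /= => te; have [f [fS tf xfe]] := topE e eS.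
  exists f; first by rewrite inE fS.
  rewrite xfe eqxx /= ltn_neqAle (topP _ _ tf eS (esym xfe)) andbT.
  by rewrite (inj_eq r_inj) (_ : e != f) //; apply: contraNneq te => ->.
Qed.

Section Galvin.
Variables (E C X Y : finType) (c0 : C) (x : E -> X) (y : E -> Y) (r : E -> nat).
Hypothesis r_inj : injective r.

(** The out-neighbors of [e] in an orientation of the line graph; the stable matchings above are
    kernels of its induced subgraphs. *)
Definition dominating (S : {set E}) (e : E) : {set E} :=
  [set f in S | (x f == x e) && (r e < r f) || (y f == y e) && (r f < r e)].

(** Give a color [a] to a kernel of the edges whose lists contain it, and delete [a] from the other
    lists. An edge that loses [a] also loses a dominating edge, so the strict inequality survives
    for the induction. *)
Lemma galvin_list_coloring (S : {set E}) (L : E -> {set C}) :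
  (forall e, e \in S -> #|dominating S e| < #|L e|) ->
  exists c : E -> C, (forall e, e \in S -> c e \in L e) /\
    forall e f, e \in S -> f \in S -> e != f -> (x e == x f) || (y e == y f) ->
      c e != c f.
Proof.
move: {2}#|S| (leqnn #|S|) => N; elim: N S L => [|N IH] S L SN HL.
  move: SN; rewrite leqn0 cards_eq0 => /eqP->; exists (fun=> c0).
  by split=> [e|e f]; rewrite inE.
have [S0|[e0 e0S]] := set_0Vmem S.
  by exists (fun=> c0); rewrite S0; split=> [e|e f]; rewrite inE.
have /card_gt0P[a aL] : 0 < #|L e0| by apply: leq_ltn_trans (HL _ e0S).
have [M [MS Mind Mabs]] := kernel_exists x y [set e in S | a \in L e] r_inj.
have MSS : M \subset S by apply: subset_trans MS _; apply/subsetP => e; rewrite inE => /andP[].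
have Mn0 : 0 < #|M|.
  apply/card_gt0P; have [e0M|e0M] := boolP (e0 \in M); first by exists e0.
  by have [|f fM _] := Mabs e0 _ e0M; [rewrite inE e0S|exists f].
have S'N : #|S :\: M| <= N by rewrite cardsD (setIidPr MSS); lia.
have [|c [cL cP]] := IH (S :\: M) (fun e => L e :\ a) S'N.
  move=> e; rewrite inE => /andP[eM eS].
  have sub : dominating (S :\: M) e \subset dominating S e.
    by apply/subsetP => f; rewrite !inE => /andP[/andP[_ ->]].
  have := HL e eS; have [aLe|aLe] := boolP (a \in L e); last first.
    rewrite (cardsD1 a (L e)) (negPf aLe) add0n.
    exact: leq_ltn_trans (subset_leq_card sub).
  have [|f fM dom] := Mabs e _ eM; first by rewrite inE eS.
  have fS := subsetP MSS f fM.
  rewrite (cardsD1 a (L e)) aLe add1n ltnS; apply: leq_trans.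
  rewrite (cardsD1 f (dominating S e)) [f \in _]inE fS dom add1n ltnS.
  apply: subset_leq_card; apply/subsetP => g gd; rewrite !inE.
  have /[!inE] /andP[/andP[gM gS] ->] := gd.
  by rewrite gS /= andbT; apply: contraNneq gM => ->.
exists (fun e => if e \in M then a else c e); split=> [e eS|e f eS fS ef inc].
  case: ifP => eM.
    by move/(subsetP MS): eM; rewrite inE => /andP[].
  by have := cL e; rewrite !inE eM eS => /(_ isT)/andP[].
have ca g : g \in S -> g \notin M -> c g != a.
  by move=> gS gM; have := cL g; rewrite !inE gM gS => /(_ isT)/andP[].
case: ifP => eM; case: ifP => fM.
- by have [/negPf n1 /negPf n2] := Mind e f eM fM ef; rewrite n1 n2 in inc.
- by rewrite eq_sym ca // fM.
- by rewrite ca // eM.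
- by apply: cP; rewrite ?inE ?eM ?fM.
Qed.
End Galvin.

Lemma greedy_list_coloring (E C : finType) (c0 : C) (adj : rel E) (S : {set E})
    (L : E -> {set C}) :
  symmetric adj ->
  (forall e, e \in S -> #|[set f in S | (f != e) && adj e f]| < #|L e|) ->
  exists c : E -> C, (forall e, e \in S -> c e \in L e) /\
    forall e f, e \in S -> f \in S -> e != f -> adj e f -> c e != c f.
Proof.
move=> adjC; move: {2}#|S| (erefl #|S|) => N; elim: N S => [|N IH] S SN HL.
  move/eqP: SN; rewrite cards_eq0 => /eqP->; exists (fun=> c0).
  by split=> [e|e f]; rewrite inE.
have /card_gt0P[e eS] : 0 < #|S| by rewrite SN.
have S'N : #|S :\ e| = N by move: SN; rewrite (cardsD1 e) eS => -[].
have [|c [cL cP]] := IH _ S'N.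
  move=> f; rewrite inE => /andP[_ fS]; apply: leq_ltn_trans (HL f fS).
  by apply/subset_leq_card/subsetP => g; rewrite !inE => /andP[/andP[_ ->]].
set Nb := [set f in S | (f != e) && adj e f].
have /card_gt0P[a] : 0 < #|L e :\: c @: Nb|.
  rewrite cardsD subn_gt0; apply: leq_ltn_trans (HL e eS).
  apply: leq_trans (leq_imset_card c Nb).
  by apply: subset_leq_card; apply: subsetIr.
rewrite inE => /andP[aN aL].
exists (fun f => if f == e then a else c f); split=> [f fS|f g fS gS fg adjfg].
  by have [->//|fe] := eqVneq f e; apply: cL; rewrite !inE fe.
have aC h : h \in S -> h != e -> adj e h -> a != c h.
  move=> hS he eh; apply: contraNneq aN => ->; apply: imset_f.
  by rewrite inE hS he.
have [fe|fe] := eqVneq f e; have [ge|ge] := eqVneq g e.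
- by rewrite fe ge eqxx in fg.
- by apply: aC => //; rewrite -fe.
- by rewrite eq_sym; apply: aC => //; rewrite -ge adjC.
- by apply: cP; rewrite ?inE ?fe ?ge.
Qed.

(** * List edge colorings of multigraphs *)

(** Only the presence of [a] and [b] can change. If F has at most one edge of these colors, it shows
    at most one of them before and equally many after; if it has two or more, both colors occur
    after. *)
Lemma recoloring_card (E C : finType) (c : E -> C) (d : E -> bool) (a b : C)
    (F : {set E}) :
  let sel e := (c e == a) || (c e == b) in
  let c' e := if sel e then (if d e then a else b) else c e in
  a != b ->
  (1 < #|[set e in F | sel e]| -> forall i, exists e, [/\ e \in F, sel e & d e = i]) ->
  #|c @: F| <= #|c' @: F| /\
  (a \notin c @: F -> 1 < #|[set e in F | sel e]| -> #|c @: F| < #|c' @: F|).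
Proof.
move=> sel c' ab both; set G := [set e in F | sel e] in both *.
pose AB := [set a; b].
have selE e : sel e = (c e \in AB) by rewrite !inE.
have c'AB e : (c' e \in AB) = sel e.
  rewrite /c' selE; case: ifP => [_|->//]; by case: (d e); rewrite !inE eqxx ?orbT.
have out : c @: F :\: AB = c' @: F :\: AB.
  apply/setP => i; rewrite !in_setD; case: (boolP (i \in AB)) => //= iAB.
  apply/imsetP/imsetP => -[e eF ie]; exists e => //.
    by rewrite /c' selE -ie (negPf iAB).
  by move: iAB; rewrite ie c'AB /c' => /negPf->.
rewrite -(cardsID AB (c @: F)) -(cardsID AB (c' @: F)) out leq_add2r ltn_add2r.
have le2 : #|c @: F :&: AB| <= 2.
  have <- : #|AB| = 2 by rewrite cards2 ab.
  by rewrite subset_leq_card ?subsetIr.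
have leG : #|c @: F :&: AB| <= #|G|.
  apply: leq_trans (leq_imset_card c G); apply: subset_leq_card.
  apply/subsetP => i; rewrite inE => /andP[/imsetP[e eF ->] ceAB].
  by apply: imset_f; rewrite inE eF selE.
have c'2 : 1 < #|G| -> #|c' @: F :&: AB| = 2.
  move=> /both bt; rewrite (setIidPr _) ?cards2 ?ab //; apply/subsetP => i.
  have [e1 [e1F s1 d1]] := bt true; have [e2 [e2F s2 d2]] := bt false.
  rewrite !inE => /orP[]/eqP->.
    by apply/imsetP; exists e1; rewrite // /c' s1 d1.
  by apply/imsetP; exists e2; rewrite // /c' s2 d2.
split=> [|aN G2]; last first.
  rewrite c'2 // ltnS -(cards1 b) subset_leq_card //; apply/subsetP => i.
  rewrite !inE => /andP[iF /orP[/eqP ia|//]]; by rewrite -ia iF in aN.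
have [G2|G1] := ltnP 1 #|G|; first by rewrite c'2.
apply: leq_trans leG _; case: (set_0Vmem G) => [->|[e]]; first by rewrite cards0.
rewrite inE => /andP[eF se]; apply: leq_trans G1 _.
by apply/card_gt0P; exists (c' e); rewrite inE c'AB se andbT imset_f.
Qed.

(* Gupta's theorem, in the version with min(k, degree) colors at each vertex. *)
Lemma gupta_coloring (E X Y : finType) (x : E -> X) (y : E -> Y) (S : {set E})
    (k : nat) :
  exists c : E -> 'I_k.+1,
    (forall v, minn k.+1 #|[set e in S | x e == v]| <=
               #|c @: [set e in S | x e == v]|) /\
    (forall v, minn k.+1 #|[set e in S | y e == v]| <=
               #|c @: [set e in S | y e == v]|).
Proof.
pose F (z : X + Y) := match z with
  | inl v => [set e in S | x e == v] | inr v => [set e in S | y e == v] end.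
pose phi (c : {ffun E -> 'I_k.+1}) := \sum_z #|c @: F z|.
(* The coloring maximizes the total number of colors seen, summed over the vertices of both
   sides. *)
case: (@arg_maxnP _ [ffun=> ord0] predT phi isT) => c _ cmax.
suff good z : minn k.+1 #|F z| <= #|c @: F z|.
  by exists c; split=> v; [exact: good (inl v)|exact: good (inr v)].
rewrite leqNgt; apply/negP; rewrite leq_min => /andP[ck cF].
have [a aN] : exists a, a \notin c @: F z.
  have : 0 < #|~: (c @: F z)| by rewrite cardsCs setCK card_ord subn_gt0.
  by case/card_gt0P => a; rewrite inE; exists a.
(* A deficient vertex misses a color [a] and repeats a color [b]; recoloring the edges of these two
   colors alternately raises the total. *)
have [e eF [f /andP[/= ef fF] cef]] : exists2 e, e \in F z &
    exists2 f, f \in [predD1 F z & e] & c e = c f.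
  apply/dinjectivePn; apply: contraL cF => /dinjectiveP/imset_injP/eqP->.
  by rewrite ltnn.
pose b := c e.
have ab : a != b by apply: contraNneq aN => ->; apply: imset_f.
pose sel e := (c e == a) || (c e == b).
have [d [dx dy]] := bipartite_2coloring x y [set e in S | sel e].
have both z' : 1 < #|[set e in F z' | sel e]| ->
    forall i, exists e, [/\ e \in F z', sel e & d e = i].
  case: z' => v; rewrite /F => H i.
    have [|g [gS xg dg]] := dx v i.
      by apply: leq_trans H _; apply/subset_leq_card/subsetP => g; rewrite !inE -!andbA => /and3P[-> -> ->].
    by exists g; move: gS; rewrite !inE xg eqxx => /andP[-> ->].
  have [|g [gS xg dg]] := dy v i.
    by apply: leq_trans H _; apply/subset_leq_card/subsetP => g; rewrite !inE -!andbA => /and3P[-> -> ->].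
  by exists g; move: gS; rewrite !inE xg eqxx => /andP[-> ->].
pose c' := [ffun e => if sel e then (if d e then a else b) else c e].
have step z' := recoloring_card ab (both z').
have c'E z' : c' @: F z' = (fun e => if sel e then (if d e then a else b) else c e) @: F z'.
  by apply: eq_imset => g; rewrite ffunE.
have : phi c' <= phi c by exact: cmax.
rewrite leqNgt => /negP; apply.
rewrite /phi (bigD1 z) //= [X in _ < X](bigD1 z) //= -addSn leq_add //.
  rewrite c'E; apply: (step z).2 => //.
  have <- : #|[set e; f]| = 2 by rewrite cards2 eq_sym ef.
  apply/subset_leq_card/subsetP => g; rewrite !inE => /orP[]/eqP->.
    by rewrite eF /sel /b eqxx orbT.
  by rewrite fF /sel /b cef eqxx orbT.
by apply: leq_sum => z' _; rewrite c'E; exact: (step z').1.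
Qed.

Lemma card_ord_lt (n m : nat) : m <= n -> #|[set i : 'I_n | i < m]| = m.
Proof.
move=> mn; rewrite -sum1dep_card -(big_ord_widen _ (fun=> 1) mn).
by rewrite sum1_card card_ord.
Qed.

(** Edges are ranked by a Gupta coloring with k colors. Of the k - 1 colors other than that of [e],
    the lower ones are sought at [x e] and the higher ones at [y e]; a vertex of degree d misses at
    most k - d of them, truncated at 0. This limits the edges dominating [e] in Galvin's
    argument. *)
Lemma balanced_rank (E X Y : finType) (x : E -> X) (y : E -> Y) (S : {set E})
    (k : nat) :
  exists r : E -> nat, injective r /\ forall e, e \in S ->
    k <= 1 + #|[set f in [set f in S | x f == x e] | r f < r e]|
           + #|[set f in [set f in S | y f == y e] | r e < r f]|
           + (k - #|[set f in S | x f == x e]|)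
           + (k - #|[set f in S | y f == y e]|).
Proof.
case: k => [|k]; first by exists (fun e => nat_of_ord (enum_rank e)); split=> // e f /ord_inj/enum_rank_inj.
have [c [cx cy]] := gupta_coloring x y S k.
(* Lexicographic order: color first, ties broken by enumeration. *)
pose r e := c e * #|E| + nat_of_ord (enum_rank e).
have rlt e f : c e < c f -> r e < r f.
  move=> cef; have re : nat_of_ord (enum_rank e) < #|E| by exact: ltn_ord.
  have : (c e).+1 * #|E| <= c f * #|E| by rewrite leq_mul2r cef orbT.
  by rewrite /r mulSn; lia.
exists r; split=> [e f ref|e eS].
  have := rlt e f; have := rlt f e; rewrite ref ltnn.
  case: (ltngtP (c e) (c f)) => [_ _ /(_ isT)//|_ /(_ isT)//|cef _ _].
  by move: ref; rewrite /r cef => /addnI/ord_inj/enum_rank_inj.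
(* Inclusion-exclusion among the k + 1 colors, for those of I and those occurring in F. *)
have lower (F : {set E}) (W I : {set _}) : W = [set f in F | c f \in I] ->
    #|I| + #|c @: F| <= k.+1 + #|W|.
  move=> ->; rewrite -cardsUI leq_add //; first by rewrite -[X in _ <= X](card_ord k.+1) max_card.
  apply: leq_trans (leq_imset_card c _); apply/subset_leq_card/subsetP => i.
  by rewrite inE => /andP[iI /imsetP[f fF if_]]; rewrite if_ imset_f // inE fF -if_.
have ltc : #|[set i : 'I_k.+1 | i < c e]| = c e by rewrite card_ord_lt // ltnW.
have gtc : #|[set i : 'I_k.+1 | c e < i]| = k - c e.
  have -> : [set i : 'I_k.+1 | c e < i] = ~: [set i : 'I_k.+1 | i < (c e).+1].
    by apply/setP => i; rewrite !inE ltnS ltnNge.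
  by rewrite cardsCs setCK card_ord card_ord_lt // subSS.
have lx := lower [set f in S | x f == x e] _ [set i : 'I_k.+1 | i < c e] erefl.
have ly := lower [set f in S | y f == y e] _ [set i : 'I_k.+1 | c e < i] erefl.
have := cx (x e); have := cy (y e).
set Fx := [set f in S | x f == x e] in lx *.
set Fy := [set f in S | y f == y e] in ly *.
have sx : #|[set f in Fx | c f \in [set i : 'I_k.+1 | i < c e]]| <= #|[set f in Fx | r f < r e]|.
  by apply/subset_leq_card/subsetP => f; rewrite !inE => /andP[-> /rlt->].
have sy : #|[set f in Fy | c f \in [set i : 'I_k.+1 | c e < i]]| <= #|[set f in Fy | r e < r f]|.
  by apply/subset_leq_card/subsetP => f; rewrite !inE => /andP[-> /rlt->].
have := ltn_ord (c e); rewrite ltc in lx; rewrite gtc in ly.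
lia.
Qed.

Lemma card_trichotomy (E : finType) (r : E -> nat) (F : {set E}) (e : E) :
  injective r -> e \in F ->
  #|[set f in F | r f < r e]| + #|[set f in F | r e < r f]| < #|F|.
Proof.
move=> r_inj eF; rewrite (cardsD1 e F) eF add1n ltnS.
rewrite -(cardsID [set f | r f < r e] (F :\ e)) leq_add //.
  apply/subset_leq_card/subsetP => f; rewrite !inE => /andP[-> lt]; rewrite lt !andbT.
  by apply: contraTneq lt => ->; rewrite ltnn.
apply/subset_leq_card/subsetP => f; rewrite !inE => /andP[-> lt].
rewrite -leqNgt ltnW //= andbT.
by apply: contraTneq lt => ->; rewrite ltnn.
Qed.

Section ShannonList.
Variables (V E : finType) (ends : E -> {set V}) (S : {set E}).
Hypothesis ends2 : forall e, e \in S -> #|ends e| = 2.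

Let cut (P : {set V}) := [set e in S | #|ends e :&: P| == 1].

(** Moving v across exchanges the cut and uncut edges at v and affects no others, so a maximum cut
    contains at least half of the edges at every vertex. *)
Lemma max_cut_half : exists P : {set V}, forall v,
  #|[set e in S :\: cut P | v \in ends e]| <= #|[set e in cut P | v \in ends e]|.
Proof.
case: (@arg_maxnP _ set0 predT (fun P => #|cut P|) isT) => P _ Pmax.
exists P => v; pose I := [set e | v \in ends e].
pose P' := if v \in P then P :\ v else v |: P.
have : #|cut P'| <= #|cut P| by exact: Pmax.
rewrite -(cardsID I (cut P)) -(cardsID I (cut P')).
have -> : cut P' :\: I = cut P :\: I.
  apply/setP => e; rewrite !inE; case: (boolP (v \in ends e)) => //= ve.
  congr (_ && (#|pred_of_set _| == _)); apply/setP => w; rewrite !inE.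
  case: (boolP (w \in ends e)) => //= we.
  have wv : w != v by apply: contraTneq we => ->.
  by rewrite /P'; case: ifP => _; rewrite !inE (negPf wv).
rewrite leq_add2r => le; apply: (@leq_trans #|cut P' :&: I|); last first.
  by apply: leq_trans le _; apply/subset_leq_card/subsetP => e; rewrite !inE.
apply/subset_leq_card/subsetP => e; rewrite !inE => /andP[/andP[nc eS] ve].
rewrite eS ve /= andbT; move: nc; rewrite eS /= => nc.
have := ends2 eS; rewrite -(cardsID P (ends e)) => c2.
move: nc; rewrite /P'; case: ifPn => vP nc.
  have -> : ends e :&: (P :\ v) = (ends e :&: P) :\ v.
    by apply/setP => w; rewrite !inE andbCA.
  have := cardsD1 v (ends e :&: P); rewrite inE ve vP /= => E1.
  by apply/eqP; lia.
have -> : ends e :&: (v |: P) = v |: (ends e :&: P).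
  by apply/setP => w; rewrite !inE; case: eqP => [->|] //=; rewrite ve.
rewrite cardsU1 inE ve (negPf vP) /=.
have := cardsD1 v (ends e :\: P); rewrite !inE ve vP /= => E1.
by apply/eqP; lia.
Qed.

(* Borodin, Kostochka and Woodall: the list version of Shannon's bound. The
   edges outside a maximum cut are colored greedily, those of the cut by
   Galvin's argument. *)
Lemma shannon_list_coloring (C : finType) (c0 : C) (L : E -> {set C}) (D : nat) :
  (forall v, #|[set e in S | v \in ends e]| <= D) ->
  (forall e, e \in S -> D + D./2 <= #|L e|) ->
  exists c : E -> C, (forall e, e \in S -> c e \in L e) /\
    forall e f, e \in S -> f \in S -> e != f -> ends e :&: ends f != set0 ->
      c e != c f.
Proof.
move=> degD HL; have [P half] := max_cut_half.
set H := cut P in half; set N := S :\: H in half.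
pose dH v := #|[set e in H | v \in ends e]|.
pose dN v := #|[set e in N | v \in ends e]|.
have HS e : e \in H -> e \in S by rewrite inE => /andP[].
have NS e : e \in N -> e \in S by rewrite inE => /andP[].
have dHN v : dH v + dN v <= D.
  apply: leq_trans (degD v); rewrite -(cardsID H [set e in S | v \in ends e]).
  apply: leq_add; apply/subset_leq_card/subsetP => e; rewrite !inE.
    by move=> /andP[/andP[-> ->] ->].
  by move=> /andP[/andP[-> ->] ->].
have adjC : symmetric (fun e f => ends e :&: ends f != set0).
  by move=> e f; rewrite setIC.
have nbr (T : {set E}) e u w : ends e = [set u; w] ->
    #|[set f in T | ends e :&: ends f != set0]| <=
    #|[set f in T | u \in ends f]| + #|[set f in T | w \in ends f]|.
  move=> ee; apply: leq_trans (leq_card_setU _ _); apply/subset_leq_card/subsetP => f.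
  rewrite !inE => /andP[-> /set0Pn[z]]; rewrite ee !inE => /andP[/orP[]/eqP-> ->] //.
  by rewrite orbT.
(* At most half of the degree at a vertex is uncut, so an uncut edge uw meets fewer than dN u + dN w
   <= D uncut edges. *)
have [|cN [cNL cNP]] := @greedy_list_coloring _ C c0 (fun e f => ends e :&: ends f != set0) N L adjC.
  move=> e eN; have eS := NS e eN.
  have /eqP/cards2P[u [w [uw ee]]] := ends2 eS.
  apply: leq_trans (HL e eS); apply: (@leq_trans D); last exact: leq_addr.
  apply: (@leq_trans (dN u + dN w)); last first.
    by have := half u; have := half w; have := dHN u; have := dHN w; rewrite -/(dN u) -/(dN w) -/(dH u) -/(dH w); lia.
  apply: leq_trans (nbr N e u w ee).
  rewrite [X in _ < X](cardsD1 e) inE eN setIid -cards_eq0 (ends2 eS) add1n ltnS.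
  by apply/subset_leq_card/subsetP => f; rewrite !inE => /andP[-> /andP[-> ->]].
(* The ends inside and outside P make the cut bipartite; the default [None] does not arise on H. *)
pose x e := [pick v in ends e :&: P]; pose y e := [pick v in ends e :\: P].
have Hends e : e \in H -> exists u w,
    [/\ ends e = [set u; w], u \in P, w \notin P, x e = Some u & y e = Some w].
  rewrite inE => /andP[eS /cards1P[u Eu]].
  have : #|ends e :\: P| == 1.
    by have := ends2 eS; rewrite -(cardsID P) Eu cards1 add1n => -[->].
  case/cards1P => w Ew.
  have /setIP[_ uP] : u \in ends e :&: P by rewrite Eu inE.
  have /setDP[_ wP] : w \in ends e :\: P by rewrite Ew inE.
  exists u, w; split=> //; first by rewrite -(setID (ends e) P) Eu Ew.
    by rewrite /x; case: pickP => [v|/(_ u)]; rewrite Eu inE ?eqxx // => /eqP->.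
  by rewrite /y; case: pickP => [v|/(_ w)]; rewrite Ew inE ?eqxx // => /eqP->.
have xP f u : u \in P -> f \in H -> (x f == Some u) = (u \in ends f).
  move=> uP /Hends[u' [w' [-> u'P w'P -> _]]]; rewrite !inE.
  have /negPf-> : u != w' by apply: contraNneq w'P => <-.
  by rewrite orbF; apply/eqP/eqP => [[]|->].
have yP f w : w \notin P -> f \in H -> (y f == Some w) = (w \in ends f).
  move=> wP /Hends[u' [w' [-> u'P w'P _ ->]]]; rewrite !inE.
  have /negPf-> : w != u' by apply: contraNneq wP => ->.
  by apply/eqP/eqP => [[]|->].
(* The choice k = ceil(D/2) makes 2D - k equal to D + floor(D/2), the list size. *)
have [r [r_inj rk]] := balanced_rank x y H (uphalf D).
(* The uncut neighbors cost an edge uw of the cut at most dN u + dN w colors. *)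
pose L' e := L e :\: cN @: [set f in N | ends e :&: ends f != set0].
have [|cH [cHL cHP]] := galvin_list_coloring c0 r_inj (S := H) (L := L') (x := x) (y := y).
  move=> e eH; have eS := HS e eH; have [u [w [ee uP wP xe ye]]] := Hends e eH.
  have := rk e eH.
  set Fx := [set f in H | x f == x e]; set Fy := [set f in H | y f == y e].
  have FxE : #|Fx| = dH u.
    apply: eq_card => f; rewrite [LHS]in_set [RHS]in_set xe.
    by have [fH|//] := boolP (f \in H); rewrite xP.
  have FyE : #|Fy| = dH w.
    apply: eq_card => f; rewrite [LHS]in_set [RHS]in_set ye.
    by have [fH|//] := boolP (f \in H); rewrite yP.
  have tx := @card_trichotomy _ r Fx e r_inj; have ty := @card_trichotomy _ r Fy e r_inj.
  have eFx : e \in Fx by rewrite in_set eH eqxx.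
  have eFy : e \in Fy by rewrite in_set eH eqxx.
  move: (tx eFx) (ty eFy) => {}tx {}ty.
  have dom : #|dominating x y r H e| <=
      #|[set f in Fx | r e < r f]| + #|[set f in Fy | r f < r e]|.
    apply: leq_trans (leq_card_setU _ _); apply/subset_leq_card/subsetP => f.
    rewrite in_set => /andP[fH /orP[]/andP[Ef lt]].
      by apply/setUP; left; apply/setIdP; split=> //; apply/setIdP.
    by apply/setUP; right; apply/setIdP; split=> //; apply/setIdP.
  have L'c : #|L e| <= #|L' e| + (dN u + dN w).
    rewrite -(cardsID (cN @: [set f in N | ends e :&: ends f != set0]) (L e)) addnC leq_add2l.
    apply: leq_trans (nbr N e u w ee); apply: leq_trans (leq_imset_card cN _).
    exact: subset_leq_card (subsetIr _ _).
  have := half u; have := half w; have := dHN u; have := dHN w.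
  rewrite -/(dN u) -/(dN w) -/(dH u) -/(dH w); have := HL e eS.
  have := uphalf_half D; have := odd_double_half D; rewrite FxE in tx *; rewrite FyE in ty *.
  lia.
exists (fun e => if e \in H then cH e else cN e); split=> [e eS|e f eS fS ef inc].
  case: ifP => eH; first by have := cHL e eH; rewrite inE => /andP[].
  by apply: cNL; rewrite inE eH.
have HN g h : g \in H -> h \in N -> ends g :&: ends h != set0 -> cH g != cN h.
  move=> gH hN gh; have := cHL g gH; rewrite inE => /andP[+ _].
  by apply: contraNneq => ->; apply: imset_f; rewrite inE hN.
case: ifP => eH; case: ifP => fH.
- apply: cHP => //; have [u [w [ee uP wP xe ye]]] := Hends e eH.
  case/set0Pn: inc => z; rewrite ee !inE => /andP[/orP[]/eqP-> zf].
    by rewrite xe eq_sym xP ?zf.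
  by rewrite ye orbC eq_sym yP ?zf.
- by apply: HN => //; rewrite in_setD fH.
- by rewrite eq_sym; apply: HN => //; rewrite ?in_setD ?eH // setIC.
- by apply: cNP => //; rewrite in_setD ?eH ?fH.
Qed.
End ShannonList.

(** * Balancing a proper coloring *)

(** With y = x - 2z, the alternatives are |y + u|^2 and |y - u|^2 in the plane. The one whose inner
    product term is nonpositive is at most |y|^2 + |u|^2, and |u|^2 <= 4. *)
Lemma sign_balance (x1 x2 z1 z2 u1 u2 : int) (t : nat) :
  ((x1 - 2 * z1) ^+ 2 + (x2 - 2 * z2) ^+ 2 <= t%:Z)%R -> (`|u1| + `|u2| <= 2)%R ->
  ((u1 + x1 - 2 * z1) ^+ 2 + (u2 + x2 - 2 * z2) ^+ 2 <= t%:Z + 4)%R \/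
  ((u1 + x1 - 2 * (u1 + z1)) ^+ 2 + (u2 + x2 - 2 * (u2 + z2)) ^+ 2 <= t%:Z + 4)%R.
Proof.
set y1 := (x1 - 2 * z1)%R; set y2 := (x2 - 2 * z2)%R => Hy Hu.
have -> : (u1 + x1 - 2 * z1 = y1 + u1)%R by rewrite /y1; ring.
have -> : (u2 + x2 - 2 * z2 = y2 + u2)%R by rewrite /y2; ring.
have -> : (u1 + x1 - 2 * (u1 + z1) = y1 - u1)%R by rewrite /y1; ring.
have -> : (u2 + x2 - 2 * (u2 + z2) = y2 - u2)%R by rewrite /y2; ring.
have u4 : (u1 ^+ 2 + u2 ^+ 2 <= 4)%R.
  rewrite -[(u1 ^+ 2)%R]real_normK ?num_real // -[(u2 ^+ 2)%R]real_normK ?num_real //.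
  by move: Hu (normr_ge0 u1) (normr_ge0 u2); nra.
have [le|/ltW le] := lerP (y1 * u1 + y2 * u2)%R 0%R; [left|right]; nra.
Qed.

Section Balance.
Variables (A E C : finType) (cov : E -> {set A}).
Hypothesis cov2 : forall e, #|cov e| <= 2.

(** In the application [cov e] is the set of ends of [e] in A; an edge inside B covers nothing and
    conflicts with no edge. *)
Definition cov_proper (c : E -> C) : Prop :=
  forall e f, e != f -> c e = c f -> cov e :&: cov f = set0.

(** Used with [covw], for the points that a color covers, and with [single], for its cross edges. *)
Definition class_weight (g : E -> nat) (c : E -> C) (i : C) : nat :=
  \sum_(e | c e == i) g e.

Definition covw (e : E) : nat := #|cov e|.
Definition single (e : E) : nat := #|cov e| == 1.

Lemma class_covw_le (c : E -> C) (i : C) :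
  cov_proper c -> class_weight covw c i <= #|A|.
Proof.
move=> cP; rewrite /class_weight /covw.
under eq_bigr do rewrite -sum1_card.
rewrite (exchange_big_dep predT) //= -sum1_card; apply: leq_sum => v _.
rewrite sum1dep_card -(cards1 v); have [->|[e]] := set_0Vmem [set e | (c e == i) && (v \in cov e)].
  by rewrite cards0.
rewrite inE => /andP[/eqP ce ve]; rewrite cards1 -(cards1 e).
apply/subset_leq_card/subsetP => f; rewrite !inE => /andP[/eqP cf vf].
apply: contraTT isT => fe; have := cP f e fe; rewrite ce cf => /(_ erefl)/setP/(_ v).
by rewrite !inE vf ve.
Qed.

Section TwoColors.
Variables (c : E -> C) (a b : C).
Hypotheses (cP : cov_proper c) (ab : a != b).

Let sel : {set E} := [set e | (c e == a) || (c e == b)].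
(** A closed subset of [sel] is a union of Kempe chains: exchanging [a] and [b] on it keeps the
    coloring proper. *)
Let closed (T : {set E}) : Prop :=
  forall e f, e \in T -> f \in sel -> cov e :&: cov f != set0 -> f \in T.

(** The excess of color [a] over color [b] on T, which an exchange on T negates. *)
Let dif (g : E -> nat) (T : {set E}) : int :=
  (\sum_(e in T) (((c e == a)%:Z - (c e == b)%:Z) * (g e)%:Z))%R.

Let colorsum (g : E -> nat) (S : {set E}) (i : C) := \sum_(e in S | c e == i) g e.

Lemma difE g (S : {set E}) :
  dif g S = ((colorsum g S a)%:Z - (colorsum g S b)%:Z)%R.
Proof.
rewrite /dif /colorsum !(big_morph Posz PoszD (erefl _)) big_mkcondr /=.
rewrite [X in (_ = _ - X)%R]big_mkcondr /= -sumrB; apply: eq_bigr => e _.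
by do 2!case: eqP => _ /=; lia.
Qed.

(* Take S maximal with at least |S| - 1 doubly covered points: a further edge
   meeting S would create a new such point. *)
Lemma small_closed_set (T : {set E}) (e0 : E) : T \subset sel -> closed T -> e0 \in T ->
  exists S : {set E}, [/\ S \subset T, e0 \in S, closed S &
    (`|dif covw S| + `|dif single S| <= 2)%R].
Proof.
move=> Tsel Tcl e0T.
pose cv (S : {set E}) i := \bigcup_(e in S | c e == i) cov e.
pose dbl S := cv S a :&: cv S b.
have cvP (S : {set E}) i v : reflect (exists e, [/\ e \in S, c e = i & v \in cov e]) (v \in cv S i).
  apply: (iffP bigcupP) => [[e /andP[eS /eqP ce] ve]|[e [eS ce ve]]]; exists e => //.
  by rewrite eS ce eqxx.
pose ok (S : {set E}) := [&& e0 \in S, S \subset T & #|S| <= #|dbl S|.+1].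
have ok0 : ok [set e0] by rewrite /ok inE eqxx sub1set e0T cards1.
case: (@arg_maxnP _ _ ok (fun S => #|S|) ok0) => S /and3P[e0S ST dS] Smax.
have Ssel : S \subset sel := subset_trans ST Tsel.
exists S; split=> //.
  move=> e f eS fsel sh; apply: contraT => fS.
  have ef : e != f by apply: contraNneq fS => <-.
  have fT : f \in T by apply: Tcl (subsetP ST e eS) fsel sh.
  case/set0Pn: (sh) => v; rewrite inE => /andP[ve vf].
  have cef : c e != c f.
    by apply: contraNneq sh => cef; rewrite (cP ef cef).
  have fI : f \in f |: S by rewrite setU11.
  have eI : e \in f |: S by rewrite setU1r.
  suff /Smax : ok (f |: S) by rewrite /= cardsU1 fS add1n ltnn.
  rewrite /ok setU1r // subUset sub1set fT ST cardsU1 fS add1n ltnS /=.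
  apply: leq_trans dS _; apply: proper_card; apply/properP; split.
    apply/subsetP => u; rewrite !inE => /andP[/cvP[g [gS cg ug]] /cvP[h [hS ch uh]]].
    by apply/andP; split; apply/cvP; [exists g|exists h]; rewrite setU1r.
  exists v.
    have : e \in sel := subsetP Ssel e eS.
    move: fsel; rewrite !inE => /orP[]/eqP cf /orP[]/eqP ce.
    - by rewrite ce cf eqxx in cef.
    - by apply/andP; split; apply/cvP; [exists f|exists e].
    - by apply/andP; split; apply/cvP; [exists e|exists f].
    - by rewrite ce cf eqxx in cef.
  apply/negP; rewrite inE => /andP[va vb].
  have /cvP[g [gS cg vg]] : v \in cv S (c f).
    by move: fsel; rewrite inE => /orP[]/eqP->.
  have gf : g != f by apply: contraNneq fS => <-.
  by move/setP/(_ v): (cP gf cg); rewrite !inE vg vf.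
have cvle i : #|cv S i| <= colorsum covw S i.
  exact: card_bigcup_le.
have da : #|dbl S| <= colorsum covw S a.
  exact: leq_trans (subset_leq_card (subsetIl _ _)) (cvle a).
have db : #|dbl S| <= colorsum covw S b.
  exact: leq_trans (subset_leq_card (subsetIr _ _)) (cvle b).
(* An edge adds at most 2 to the four sums together, since only a cover of size 1 counts in
   [single]. Both [covw] sums are at least |S| - 1, which leaves at most 2 for the two
   differences. *)
have tot : colorsum covw S a + colorsum covw S b + (colorsum single S a + colorsum single S b)
    <= #|S| * 2.
  rewrite /colorsum addnACA -!big_split /= 2!big_mkcondr /= -big_split /=.
  rewrite -sum_nat_const; apply: leq_sum => e eS.
  have := cov2 e; rewrite /covw /single.
  case: (c e =P a) => [ca|_]; case: (c e =P b) => [cb|_] //=.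
  - by move: ab; rewrite -ca -cb eqxx.
  - by case: #|_| => [|[|[|]]].
  - by case: #|_| => [|[|[|]]].
by rewrite !difE; lia.
Qed.

(** Small closed sets are peeled off T one by one, and [sign_balance] decides whether to exchange
    colors on each. Every set uses up at least one edge and adds at most 4 to the squared
    imbalance. *)
Lemma balanced_closed_set (T : {set E}) : T \subset sel -> closed T ->
  exists S : {set E}, [/\ S \subset T, closed S &
    ((dif covw T - 2 * dif covw S) ^+ 2 + (dif single T - 2 * dif single S) ^+ 2
       <= (4 * #|T|)%:Z)%R].
Proof.
move: {2}#|T| (leqnn #|T|) => N; elim: N T => [|N IH] T TN Tsel Tcl.
  move: TN; rewrite leqn0 cards_eq0 => /eqP->; exists set0; split=> //.
    by move=> e f; rewrite inE.
  by rewrite /dif !big_set0 cards0.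
have [T0|[e0 e0T]] := set_0Vmem T.
  exists set0; split; [exact: sub0set|by move=> e f; rewrite inE|].
  by rewrite T0 /dif !big_set0 cards0.
have [S0 [S0T e0S0 S0cl S0small]] := small_closed_set Tsel Tcl e0T.
have S0pos : 0 < #|S0| by apply/card_gt0P; exists e0.
have cT : #|T| = #|S0| + #|T :\: S0| by rewrite -(cardsID S0 T) (setIidPr S0T).
have [|||S [SD Scl Sb]] := IH (T :\: S0).
- by lia.
- by apply: subset_trans Tsel; exact: subsetDl.
- move=> e f; rewrite !inE => /andP[eS0 eT] fsel sh.
  rewrite (Tcl e f) ?inE // andbT; apply: contra eS0 => fS0.
  by apply: S0cl fS0 _ _; rewrite ?(subsetP Tsel) // setIC.
have difD g (U W : {set E}) : W \subset U -> dif g U = (dif g W + dif g (U :\: W))%R.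
  by move=> WU; rewrite /dif (big_setID W) /= (setIidPr WU).
have ST : S \subset T by apply: subset_trans SD (subsetDl _ _).
have US : (S0 :|: S) :\: S0 = S.
  apply/setP => e; rewrite !inE; case: (boolP (e \in S0)) => //= eS0.
  by apply/esym/negP => /(subsetP SD); rewrite inE eS0.
have difU g : dif g (S0 :|: S) = (dif g S0 + dif g S)%R.
  by rewrite (difD g _ S0) ?subsetUl // US.
have Ucl : closed (S0 :|: S).
  move=> e f; rewrite !in_setU => /orP[eS|eS] fsel sh.
    by rewrite (S0cl e f).
  by rewrite (Scl e f) ?orbT.
have UT : S0 :|: S \subset T by rewrite subUset S0T ST.
have [small|small] := sign_balance Sb S0small.
  exists S; split=> //; rewrite !(difD _ T S0 S0T).
  apply: le_trans (_ : _ <= (4 * #|T :\: S0|)%:Z + 4)%R _; last by lia.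
  by apply: le_trans small; rewrite le_eqVlt; apply/orP; left; apply/eqP; ring.
exists (S0 :|: S); split=> //; rewrite !(difD _ T S0 S0T) !difU.
apply: le_trans (_ : _ <= (4 * #|T :\: S0|)%:Z + 4)%R _; last by lia.
by apply: le_trans small; rewrite le_eqVlt; apply/orP; left; apply/eqP; ring.
Qed.

Lemma two_color_balance : exists c' : E -> C, [/\ cov_proper c',
  forall g i, i != a -> i != b -> class_weight g c' i = class_weight g c i,
  forall g, class_weight g c' a + class_weight g c' b =
            class_weight g c a + class_weight g c b &
  (((class_weight covw c' a)%:Z - (class_weight covw c' b)%:Z) ^+ 2 +
   ((class_weight single c' a)%:Z - (class_weight single c' b)%:Z) ^+ 2
     <= (8 * #|A|)%:Z)%R].
Proof.
(* Edges with an empty cover are left out, so that |T| is at most the coverage of the two colors,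
   hence at most 2|A|; this turns 4|T| into 8|A|. *)
pose T := [set e in sel | cov e != set0].
have Tsel : T \subset sel by apply/subsetP => e; rewrite inE => /andP[].
have Tcl : closed T.
  move=> e f _ fsel; apply: contraNT; rewrite inE fsel /= negbK => /eqP->.
  by rewrite setI0.
have [S [ST Scl Sb]] := balanced_closed_set Tsel Tcl.
have Ssel : S \subset sel := subset_trans ST Tsel.
have ba : (b == a) = false by rewrite eq_sym (negPf ab).
pose sw i := if i == a then b else a.
pose c' e := if e \in S then sw (c e) else c e.
have c'sel e : ((c' e == a) || (c' e == b)) = (e \in sel).
  rewrite /c'; case: ifP => [/(subsetP Ssel)->|_]; last by rewrite inE.
  by rewrite /sw; case: ifP => _; rewrite eqxx ?orbT.
have sg e : ((c' e == a)%:Z - (c' e == b)%:Z)%R =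
    (((c e == a)%:Z - (c e == b)%:Z) *+ (e \notin S) -
     ((c e == a)%:Z - (c e == b)%:Z) *+ (e \in S))%R.
  rewrite /c'; case: ifP => [/(subsetP Ssel)|_]; last by rewrite subr0.
  by rewrite inE /sw => /orP[]/eqP->; do 2!rewrite ?eqxx ?ba ?(negPf ab) /=.
have c'P : cov_proper c'.
  move=> e f ef cef; apply/eqP/negPn/negP => sh.
  have fe : (e \in sel) = (f \in sel) by rewrite -!c'sel cef.
  have SS : (e \in S) = (f \in S).
    apply/idP/idP => [eS|fS].
      by apply: (Scl e) => //; rewrite -fe (subsetP Ssel).
    by apply: (Scl f); rewrite // ?fe ?(subsetP Ssel) // setIC.
  have cc : c e = c f.
    move: cef; rewrite /c' -SS; case: ifP => // eS.
    have := subsetP Ssel e eS; have := subsetP Ssel f; rewrite -SS => /(_ eS).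
    rewrite !inE /sw => /orP[]/eqP-> /orP[]/eqP-> //; rewrite eqxx ba => /eqP.
      by rewrite (negPf ab).
    by rewrite ba.
  by rewrite (cP ef cc) eqxx in sh.
have wdif g (d : E -> C) : ((class_weight g d a)%:Z - (class_weight g d b)%:Z =
    \sum_e ((d e == a)%:Z - (d e == b)%:Z) * (g e)%:Z)%R.
  rewrite /class_weight !(big_morph Posz PoszD (erefl _)) big_mkcond /=.
  rewrite [X in (_ - X = _)%R]big_mkcond /= -sumrB; apply: eq_bigr => e _.
  by do 2!case: eqP => _ /=; lia.
have wdifT g : (forall e, cov e = set0 -> g e = 0) ->
    ((class_weight g c' a)%:Z - (class_weight g c' b)%:Z = dif g T - 2 * dif g S)%R.
  move=> g0; rewrite wdif; under eq_bigr do rewrite sg.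
  have -> : (dif g T = \sum_e ((c e == a)%:Z - (c e == b)%:Z) * (g e)%:Z)%R.
    rewrite /dif big_mkcond /=; apply: eq_bigr => e _; case: ifP => // /negbT.
    rewrite !inE negb_and negbK => /orP[|/eqP/g0->]; last by rewrite mulr0.
    by rewrite negb_or => /andP[/negPf-> /negPf->]; rewrite subrr mul0r.
  rewrite /dif [X in (2 * X)%R]big_mkcond /= mulr_sumr -sumrB; apply: eq_bigr => e _.
  by case: (e \in S) => /=; rewrite ?mulr0n ?mulr1n; ring.
exists c'; split=> //.
- move=> g i /negPf ia /negPf ib; apply: eq_bigl => e.
  rewrite /c'; case: ifP => // /(subsetP Ssel); rewrite inE /sw => /orP[]/eqP->.
    by rewrite eqxx eq_sym ib eq_sym ia.
  by rewrite ba eq_sym ia eq_sym ib.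
- move=> g; rewrite /class_weight.
  have both d : \sum_(e | d e == a) g e + \sum_(e | d e == b) g e =
      \sum_(e | (d e == a) || (d e == b)) g e.
    rewrite [RHS](bigID (fun e => d e == a)) /=; congr (_ + _); apply: eq_bigl => e.
      by case: (d e == a); rewrite ?andbF.
    by case: (d e =P a) => [->|_] /=; rewrite ?andbT ?andbF ?(negPf ab).
  rewrite !both; apply: eq_bigl => e; rewrite c'sel inE //.
rewrite !wdifT; first last.
- by move=> e; rewrite /covw => ->; rewrite cards0.
- by move=> e; rewrite /single => ->; rewrite cards0.
apply: le_trans Sb _; rewrite lez_nat.
suff : #|T| <= class_weight covw c a + class_weight covw c b.
  by have := class_covw_le a cP; have := class_covw_le b cP; lia.
rewrite /class_weight -sum1_card.
have -> : \sum_(e in T) 1 = \sum_(e in T | c e == a) 1 + \sum_(e in T | c e == b) 1.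
  rewrite (bigID (fun e => c e == a)) /=; congr (_ + _); apply: eq_bigl => e.
  rewrite !inE; case: eqP => [->|] //=; first by rewrite (negPf ab) !andbF.
  by case: (c e == b); rewrite //= ?andbF ?andbT.
have le i : \sum_(e in T | c e == i) 1 <= \sum_(e | c e == i) covw e.
  rewrite big_mkcondl /=; apply: leq_sum => e _; case: ifP => // eT.
  by move: eT; rewrite inE /covw card_gt0 => /andP[].
by rewrite leq_add.
Qed.
End TwoColors.

(** A proper coloring with the least sum of squared weights is balanced: [two_color_balance] keeps
    the sum over two colors, so it would lower the squares of any pair with squared imbalance above
    8|A|. *)
Lemma balanced_coloring (c0 : E -> C) : cov_proper c0 ->
  exists c : E -> C, cov_proper c /\
    forall a b s, 8 * #|A| <= s * s ->
      class_weight covw c a <= class_weight covw c b + s /\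
      class_weight single c a <= class_weight single c b + s.
Proof.
move=> c0P.
pose properb (c : {ffun E -> C}) :=
  [forall e, forall f, (e != f) ==> (c e == c f) ==> (cov e :&: cov f == set0)].
have properP (c : {ffun E -> C}) : reflect (cov_proper c) (properb c).
  apply: (iffP forallP) => [H e f ef /eqP cef|H e].
    by have /forallP/(_ f)/implyP/(_ ef)/implyP/(_ cef)/eqP := H e.
  by apply/forallP => f; apply/implyP => ef; apply/implyP => /eqP cef; apply/eqP; exact: H.
pose phi (c : {ffun E -> C}) :=
  \sum_i (class_weight covw c i ^ 2 + class_weight single c i ^ 2).
have c0b : properb (finfun c0).
  by apply/properP => e f ef; rewrite !ffunE; exact: c0P.
case: (@arg_minnP _ _ properb phi c0b) => c /properP cP cmin.
exists c; split=> // a b s As.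
have [->|ab] := eqVneq a b; first by rewrite !leq_addr.
have [c' [c'P off tot bal]] := two_color_balance cP ab.
have c'b : properb (finfun c').
  by apply/properP => e f ef; rewrite !ffunE; exact: c'P.
have wE g i : class_weight g (finfun c') i = class_weight g c' i.
  by apply: eq_bigl => e; rewrite ffunE.
have ba : b != a by rewrite eq_sym.
have phiE d : phi d =
    class_weight covw d a ^ 2 + class_weight single d a ^ 2 +
    (class_weight covw d b ^ 2 + class_weight single d b ^ 2) +
    \sum_(i | (i != a) && (i != b)) (class_weight covw d i ^ 2 + class_weight single d i ^ 2).
  by rewrite /phi (bigD1 a) // (bigD1 b) //= addnA.
have : phi c <= phi (finfun c') by exact: cmin.
have rest : \sum_(i | (i != a) && (i != b))
      (class_weight covw (finfun c') i ^ 2 + class_weight single (finfun c') i ^ 2) =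
    \sum_(i | (i != a) && (i != b)) (class_weight covw c i ^ 2 + class_weight single c i ^ 2).
  by apply: eq_bigr => i /andP[ia ib]; rewrite !wE !off.
rewrite !phiE rest leq_add2r !wE.
have := tot covw; have := tot single; move: bal.
move: (class_weight covw c a) (class_weight covw c b) (class_weight covw c' a)
  (class_weight covw c' b) (class_weight single c a) (class_weight single c b)
  (class_weight single c' a) (class_weight single c' b).
move=> wa wb wa' wb' pa pb pa' pb' bal tp tw mn.
(* With x + y conserved, x^2 + y^2 = ((x + y)^2 + (x - y)^2) / 2 compares the differences. *)
move/(congr1 (fun k : nat => (k%:Z ^+ 2)%R)): tw; move/(congr1 (fun k : nat => (k%:Z ^+ 2)%R)): tp.
move: mn; rewrite -lez_nat -!mulnn !PoszD !PoszM => mn tp tw.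
have key : ((wa%:Z - wb%:Z) ^+ 2 + (pa%:Z - pb%:Z) ^+ 2 <= (8 * #|A|)%:Z)%R.
  apply: le_trans bal; move: mn tp tw.
  move: (wa%:Z)%R (wb%:Z)%R (wa'%:Z)%R (wb'%:Z)%R (pa%:Z)%R (pb%:Z)%R (pa'%:Z)%R (pb'%:Z)%R.
  by move=> x1 x2 x3 x4 x5 x6 x7 x8; nra.
have sq (x y : nat) : ((x%:Z - y%:Z) ^+ 2 <= (8 * #|A|)%:Z)%R -> x <= y + s.
  move=> le; have {le} : ((x%:Z - y%:Z) ^+ 2 <= (s * s)%:Z)%R by apply: le_trans le _; rewrite lez_nat.
  rewrite PoszM => le; rewrite leqNgt; apply/negP; rewrite -ltz_nat PoszD => lt.
  by move: le lt (le0z_nat s); move: (x%:Z)%R (y%:Z)%R (s%:Z)%R => X Y Z; nra.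
split; apply: sq; apply: le_trans key.
  by rewrite lerDl sqr_ge0.
by rewrite lerDr sqr_ge0.
Qed.
End Balance.

(** * Routing in the complete bipartite graph *)

Lemma Kadj_inlr n (a b : 'I_n) : Kadj (inl a) (inr b).
Proof. by rewrite /Kadj !imset_f. Qed.

Lemma Kadj_inrl n (a b : 'I_n) : Kadj (inr b) (inl a).
Proof. by rewrite Kadj_sym Kadj_inlr. Qed.

Section CompleteBipartiteRealization.
Variables (n : nat) (D : multigraph (Kvert n)).

Definition covA (e : edge D) : {set 'I_n} := [set i | inl i \in ends e].
Definition covB (e : edge D) : {set 'I_n} := [set i | inr i \in ends e].

Lemma ends_cov e : ends e = (inl @: covA e) :|: (inr @: covB e) :> {set Kvert n}.
Proof.
apply/setP => -[] i; rewrite inE.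
  rewrite mem_imset; last by move=> ? ? [].
  by rewrite inE; case: imsetP => [[]//|_]; rewrite orbF.
rewrite orbC mem_imset; last by move=> ? ? [].
by rewrite inE; case: imsetP => [[]//|_]; rewrite orbF.
Qed.

Lemma card_cov e : #|covA e| + #|covB e| = 2.
Proof.
rewrite -(card_ends e) ends_cov cardsU !card_imset; [|by move=> ? ? []..].
rewrite (_ : _ :&: _ = set0) ?cards0 ?subn0 //.
by apply/setP => z; rewrite !inE; apply/negP => /andP[/imsetP[i _ ->] /imsetP[]].
Qed.

Lemma degree_covA (a : 'I_n) : #|[set e | a \in covA e]| <= max_degree D.
Proof.
apply: leq_trans (leq_bigmax (inl a : Kvert n)); apply/subset_leq_card.
by apply/subsetP => e; rewrite !inE.
Qed.

Lemma degree_covB (b : 'I_n) : #|[set e | b \in covB e]| <= max_degree D.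
Proof.
apply: leq_trans (leq_bigmax (inr b : Kvert n)); apply/subset_leq_card.
by apply/subsetP => e; rewrite !inE.
Qed.

Lemma sum_card_covA : \sum_e #|covA e| <= n * max_degree D.
Proof.
under eq_bigr do rewrite -sum1_card.
rewrite (exchange_big_dep predT) //=.
have -> : n * max_degree D = \sum_(a < n) max_degree D by rewrite sum_nat_const card_ord.
by apply: leq_sum => a _; rewrite sum1dep_card degree_covA.
Qed.

Lemma num_cross : num_edges (bip_sub D (sideA n) (sideB n)) = \sum_e (#|covA e| == 1).
Proof.
rewrite /num_edges card_sig -sum1_card big_mkcond /=; apply: eq_bigr => e _.
rewrite inE; suff -> : crosses (sideA n) (sideB n) e = (#|covA e| == 1) by case: (_ == _).
apply/exists_inP/cards1P => [[x /imsetP[i _ ->] /exists_inP[y /imsetP[j _ ->] /eqP ee]]|[i ei]].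
  by exists i; apply/setP => k; rewrite !inE ee !inE orbF.
have : #|covB e| == 1 by have := card_cov e; rewrite ei cards1 add1n => -[->].
case/cards1P => j ej; exists (inl i); first exact: imset_f.
by apply/exists_inP; exists (inr j); rewrite ?imset_f // ends_cov ei ej !imset_set1.
Qed.

(** * Edge-disjoint paths from the two colorings *)

Section Assembly.
Variables (cA cB : edge D -> 'I_n).

(* The ends of the demand that e leaves inside B once its vertex cA e is fixed;
   it is empty for an edge inside A and for a cross edge routed directly. *)
Definition relay (e : edge D) : {set 'I_n} :=
  if #|covA e| == 0 then covB e
  else if (#|covA e| == 1) && (cA e \notin covB e) then cA e |: covB e else set0.

(** The vertices of A whose edge to [b] is taken by the choice of [cA]; they are forbidden to every
    relay at [b]. *)
Definition used (b : 'I_n) : {set 'I_n} := \bigcup_(e | cA e == b) covA e.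

Definition relayed : {set edge D} := [set e | relay e != set0].

Lemma card_relay e : e \in relayed -> #|relay e| = 2.
Proof.
rewrite inE /relay; have := card_cov e; case: ifP => [/eqP-> //|_].
case: ifP => [/andP[/eqP-> cB_] c2 _|]; last by rewrite eqxx.
by rewrite cardsU1 cB_.
Qed.

Lemma usedP b a : reflect (exists2 e, cA e = b & a \in covA e) (a \in used b).
Proof.
by apply: (iffP bigcupP) => -[e /eqP ce ae]; exists e => //; apply/eqP.
Qed.

Hypothesis cA_proper : cov_proper covA cA.
Hypothesis cB_list : forall e, e \in relayed ->
  cB e \in ~: \bigcup_(b in relay e) used b.
Hypothesis cB_proper : forall e f, e \in relayed -> f \in relayed -> e != f ->
  relay e :&: relay f != set0 -> cB e != cB f.

(** A pair (a, b) stands for an edge of K_{n,n}: the first clause joins the A-ends to [cA e], the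
    second joins [cB e] to the ends of the relay. *)
Definition route (e : edge D) : {set 'I_n * 'I_n} :=
  [set z | (z.1 \in covA e) && (z.2 == cA e) ||
           [&& e \in relayed, z.1 == cB e & z.2 \in relay e]].

Lemma cB_unused e b : e \in relayed -> b \in relay e -> cB e \notin used b.
Proof.
move=> eR be; have := cB_list eR; rewrite inE; apply: contra => ub.
by apply/bigcupP; exists b.
Qed.

(** Two edges from the same clause are kept apart by properness of [cA] or of [cB], those from
    different clauses by the lists. *)
Lemma route_disjoint e f : e != f -> route e :&: route f = set0.
Proof.
move=> ef; apply/setP => -[a b]; rewrite in_setI in_set0; apply/negP.
have routeP g : (a, b) \in route g -> (a \in covA g /\ b = cA g) \/
    [/\ g \in relayed, a = cB g & b \in relay g].
  by rewrite in_set /= => /orP[/andP[ag /eqP bg]|/and3P[gR /eqP ag bg]]; [left|right].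
have mixed g h : a \in covA g -> b = cA g -> h \in relayed -> a = cB h -> b \in relay h -> False.
  move=> ag bg hR ah bh; have /negP := cB_unused hR bh; apply.
  by apply/usedP; exists g; rewrite // -ah.
case/andP => /routeP[[ae be]|[eR ae be]] /routeP[[af bf]|[fR af bf]].
- have /setP/(_ a) := cA_proper ef (etrans (esym be) bf).
  by rewrite in_setI ae af in_set0.
- exact: (mixed e f).
- exact: (mixed f e).
- have sh : relay e :&: relay f != set0 by apply/set0Pn; exists b; rewrite inE be bf.
  by have := cB_proper eR fR ef sh; rewrite -ae -af eqxx.
Qed.

Definition routed (p : gpath (Knn n)) (e : edge D) : Prop :=
  [set phead p; plast p] = ends e /\
  forall X, X \in path_edges p -> exists2 z, z \in route e & X = [set inl z.1; inr z.2].

Lemma route_path e : exists p : gpath (Knn n), routed p e.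
Proof.
have c2 := card_cov e; have ee := ends_cov e.
have [A0|A0] := eqVneq #|covA e| 0.
  have /eqP/cards2P[b [b' [bb' eB]]] : #|covB e| = 2 by rewrite A0 in c2.
  have re : relay e = [set b; b'] by rewrite /relay A0 eqxx.
  have eR : e \in relayed by rewrite inE re; apply/set0Pn; exists b; rewrite !inE eqxx.
  have pa : path (adj (Knn n)) (inr b) [:: inl (cB e); inr b'].
    by rewrite /= Kadj_inlr Kadj_inrl.
  have pu : uniq ((inr b : Kvert n) :: [:: inl (cB e); inr b']).
    by rewrite /= !inE /= ?andbT; apply: contra bb' => /eqP[->].
  exists (GPath pa pu); split.
    by rewrite /= ee eB (cards0_eq A0) imset0 set0U imsetU !imset_set1.
  move=> X; rewrite /path_edges /= !inE => /orP[]/eqP->.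
    by exists (cB e, b); [rewrite inE eR re !inE !eqxx !orbT|rewrite setUC].
  by exists (cB e, b'); [rewrite inE eR re !inE !eqxx !orbT|].
have [A1|A1] := eqVneq #|covA e| 1.
  have B1 : #|covB e| = 1 by move: c2; rewrite A1 add1n => -[].
  have /eqP/cards1P[a eA] := A1; have /eqP/cards1P[b eB] := B1.
  have eab : ends e = [set inl a; inr b] by rewrite ee eA eB !imset_set1.
  have [cb|cb] := eqVneq (cA e) b.
    have pa : path (adj (Knn n)) (inl a) [:: inr b] by rewrite /= Kadj_inlr.
    have pu : uniq ((inl a : Kvert n) :: [:: inr b]) by [].
    exists (GPath pa pu); split; first by rewrite eab.
    move=> X; rewrite /path_edges /= !inE => /eqP->.
    by exists (a, b); rewrite // inE eA inE cb !eqxx.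
  have re : relay e = [set cA e; b] by rewrite /relay A1 eB /= inE cb.
  have eR : e \in relayed by rewrite inE re; apply/set0Pn; exists b; rewrite !inE eqxx orbT.
  (* The path is simple because [a] lies in [used (cA e)], which the list of [e] avoids. *)
  have aB : a != cB e.
    have cAr : cA e \in relay e by rewrite re !inE eqxx.
    apply: contraNneq (cB_unused eR cAr) => <-.
    by apply/usedP; exists e; rewrite // eA inE.
  have pa : path (adj (Knn n)) (inl a) [:: inr (cA e); inl (cB e); inr b].
    by rewrite /= !Kadj_inlr Kadj_inrl.
  have pu : uniq ((inl a : Kvert n) :: [:: inr (cA e); inl (cB e); inr b]).
    rewrite /= !inE /= ?andbT ?orbF; apply/andP; split.
      by apply: contra aB => /eqP[->].
    by apply: contra cb => /eqP[->].
  exists (GPath pa pu); split; first by rewrite eab.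
  move=> X; rewrite /path_edges /= !inE => /or3P[]/eqP->.
  - by exists (a, cA e); rewrite // inE eA inE !eqxx.
  - by exists (cB e, cA e); [rewrite inE eR re !inE !eqxx !orbT|rewrite setUC].
  - by exists (cB e, b); rewrite // inE eR re !inE !eqxx !orbT.
have A2 : #|covA e| = 2 by move: A0 A1 c2; lia.
have /eqP/cards2P[a [a' [aa' eA]]] := A2.
have B0 : covB e = set0 by apply: cards0_eq; move: c2; rewrite A2; lia.
have pa : path (adj (Knn n)) (inl a) [:: inr (cA e); inl a'].
  by rewrite /= Kadj_inlr Kadj_inrl.
have pu : uniq ((inl a : Kvert n) :: [:: inr (cA e); inl a']).
  by rewrite /= !inE /= ?andbT; apply: contra aa' => /eqP[->].
exists (GPath pa pu); split.
  by rewrite /= ee eA B0 imset0 setU0 imsetU !imset_set1.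
move=> X; rewrite /path_edges /= !inE => /orP[]/eqP->.
  by exists (a, cA e); rewrite // inE eA !inE !eqxx.
by exists (a', cA e); [rewrite inE eA !inE !eqxx orbT|rewrite setUC].
Qed.

Lemma realizable_of_colorings : realizable (Knn n) D.
Proof.
have [P PP] := fin_all_exists route_path.
exists P; split=> [e|e f ef]; first by have [] := PP e.
apply/pred0P => X /=; apply/negP => /andP[/(PP e).2[[a b] ze EX] /(PP f).2[[a' b'] zf EX']].
have E1 : [set inl a; inr b] = [set inl a'; inr b'] :> {set Kvert n} by rewrite -EX.
have /set2P[[aa]|//] : inl a \in [set inl a'; inr b' : Kvert n] by rewrite -E1 set21.
have /set2P[//|[bb]] : inr b \in [set inl a'; inr b' : Kvert n] by rewrite -E1 set22.
rewrite -aa -bb in zf.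
by have /setP/(_ (a, b)) := route_disjoint ef; rewrite in_setI ze zf in_set0.
Qed.
End Assembly.

(** * Existence of the two colorings *)

Lemma class_weight_avg (g : edge D -> nat) (c : edge D -> 'I_n) (s b : nat) :
  (forall i, b <= class_weight g c i + s) -> n * b <= \sum_e g e + n * s.
Proof.
move=> le; have nE k : n * k = \sum_(i < n) k by rewrite sum_nat_const card_ord.
rewrite !nE (partition_big c predT) //= -big_split /=.
by apply: leq_sum => i _; exact: le.
Qed.

Lemma realizable_of_bound (s : nat) : 0 < n -> 8 * n <= s * s ->
  7 * n * max_degree D + 3 * num_edges (bip_sub D (sideA n) (sideB n)) + 7 * n * s
    <= 2 * n * n ->
  realizable (Knn n) D.
Proof.
move=> n0 sn; rewrite num_cross; set m := \sum_e _; set d := max_degree D => bound.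
pose i0 := Ordinal n0.
(* An edge conflicts in A with at most 2d others, so n colors suffice for a greedy start. *)
have dn : 2 * d < n by nia.
have covA2 e : #|covA e| <= 2 by rewrite -(card_cov e) leq_addr.
have [||cA0 [_ cA0P]] := @greedy_list_coloring _ 'I_n i0
  (fun e f => covA e :&: covA f != set0) [set: edge D] (fun=> setT).
- by move=> e f; rewrite setIC.
- move=> e _; rewrite cardsT card_ord; apply: leq_ltn_trans dn.
  apply: (@leq_trans (\sum_(a in covA e) d)); last by rewrite sum_nat_const leq_mul2r covA2 orbT.
  apply: (@leq_trans (\sum_(a in covA e) #|[set f | a \in covA f]|)); last first.
    by apply: leq_sum => a _; exact: degree_covA.
  apply: leq_trans (card_bigcup_le _ _); apply/subset_leq_card/subsetP => f.
  rewrite !inE => /and3P[_ _ /set0Pn[a]]; rewrite inE => /andP[ae af].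
  by apply/bigcupP; exists a => //; rewrite inE.
have cA0p : cov_proper covA cA0.
  move=> e f ef cef; apply/eqP/negPn/negP => sh.
  by have := cA0P e f (in_setT _) (in_setT _) ef sh; rewrite cef eqxx.
have [cA [cAp bal]] := balanced_coloring covA2 cA0p.
rewrite card_ord in bal.
pose w := class_weight (covw covA) cA; pose p := class_weight (single covA) cA.
have wle b : n * w b <= n * d + n * s.
  apply: leq_trans (class_weight_avg (fun i => (bal b i s sn).1)) _.
  by rewrite leq_add2r sum_card_covA.
have ple b : n * p b <= m + n * s by exact: class_weight_avg (fun i => (bal b i s sn).2).
(* A degree bound for the relays: [d] for the ends in B, plus the cross edges sent to the vertex. *)
pose dB := d + \max_b p b.
have dBle : n * dB <= n * d + m + n * s.
  have [|b pb] := bigop.eq_bigmax p; first by rewrite card_ord.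
  by rewrite /dB pb mulnDr -addnA leq_add2l.
have used_le b : #|used cA b| <= w b.
  exact: card_bigcup_le.
have [||cB [cBL cBP]] := @shannon_list_coloring _ _ (relay cA) (relayed cA) (@card_relay cA)
  'I_n i0 (fun e => ~: \bigcup_(b in relay cA e) used cA b) dB.
- move=> v; apply: leq_trans (_ : #|[set e | v \in covB e]| + p v <= _); last first.
    by rewrite leq_add ?degree_covB // (bigop.leq_bigmax v).
  have -> : p v = #|[set e | (cA e == v) && (#|covA e| == 1)]|.
    by rewrite /p /class_weight /single -big_mkcondr /= sum1dep_card.
  apply: leq_trans (leq_card_setU _ _); apply/subset_leq_card/subsetP => e.
  rewrite in_set => /andP[_]; rewrite /relay => ve; apply/setUP; move: ve.
  case: ifP => [_ vB|_]; first by left; rewrite in_set.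
  case: ifP => [/andP[A1 _]|_]; last by rewrite in_set0.
  by case/setU1P => [->|vB]; [right|left]; rewrite in_set ?eqxx ?A1.
- move=> e eR; have /eqP/cards2P[b [b' [bb' re]]] := card_relay eR.
  rewrite cardsCs setCK card_ord re bigcup_setU !big_set1.
  have hU : #|used cA b :|: used cA b'| <= #|used cA b| + #|used cA b'|.
    by rewrite leq_card_setU.
  have := used_le b; have := used_le b'.
  have := wle b; have := wle b'; move: (w b) (w b') => w1 w2 h1 h2 h3 h4.
  (* The list size n - w1 - w2 must reach 3/2 of dB. Inserting the averages gives 7nd + 3m + 7ns <=
     2n^2, which is [bound]. *)
  have : n * (2 * w1 + 2 * w2 + 3 * dB) <= n * (2 * n) by lia.
  rewrite leq_mul2l; have -> : (n == 0) = false by lia.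
  by rewrite orFb => H; have := odd_double_half dB; lia.
exact: realizable_of_colorings cAp cBL cBP.
Qed.
End CompleteBipartiteRealization.

(** Settles n = 0 and the values of n for which the error term is 1. *)
Lemma realizable_edgeless n (D : multigraph (Kvert n)) :
  max_degree D = 0 -> realizable (Knn n) D.
Proof.
move=> d0; have noe (e : edge D) : False.
  have /card_gt0P[v ve] : 0 < #|ends e| by rewrite card_ends.
  have : degree D v <= max_degree D by exact: bigop.leq_bigmax.
  rewrite d0 leqn0 cards_eq0 => /eqP/setP/(_ e).
  by rewrite in_set ve in_set0.
by exists (fun e => False_rect _ (noe e)); split=> e; case: (noe e).
Qed.

Lemma num_cross_le n (D : multigraph (Kvert n)) :
  num_edges (bip_sub D (sideA n) (sideB n)) <= n * max_degree D.
Proof.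
rewrite num_cross; apply: leq_trans (sum_card_covA D); apply: leq_sum => e _.
by case: #|_| => [|[]].
Qed.

(* The error term and the final estimate *)
From mathcomp Require Import all_classical all_reals topology normedtype sequences.
Import numFieldNormedType.Exports.
Local Open Scope classical_set_scope.
Local Open Scope ring_scope.

Lemma cvg_const_div_sqrt (R : realType) (k : R) : 0 <= k ->
  (Num.min 1 (k / Num.sqrt n%:R)) @[n --> \oo] --> (0 : R).
Proof.
move=> k0; apply/cvgr0Pnorm_le => e e0; near=> n.
have q0 : 0 < Num.sqrt (n%:R : R) by rewrite sqrtr_gt0; near: n; exact: nbhs_infty_gtr.
have kq : 0 <= k / Num.sqrt (n%:R : R) by rewrite divr_ge0 // ltW.
rewrite ger0_norm ?le_min ?ler01 ?kq // ge_min; apply/orP; right.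
rewrite ler_pdivrMr // mulrC -ler_pdivrMr //.
rewrite -[k / e]ger0_norm ?divr_ge0 ?(ltW e0) // -sqrtr_sqr ler_sqrt ?ler0n //.
by near: n; exact: nbhs_infty_ger.
Unshelve. all: by end_near. Qed.

Theorem theorem2 (R : realType) :
  exists eps : nat -> R,
    (forall n : nat, 0 <= eps n) /\
    (eps n @[n --> \oo] --> (0 : R)) /\
    (forall (n : nat) (D : multigraph (Kvert n)),
       (max_degree D)%:R <=
         (1 - eps n) *
         (2 * n%:R / 7
          - 3 / 7 * ((num_edges (bip_sub D (sideA n) (sideB n)))%:R / n%:R)) ->
       realizable (Knn n) D).
Proof.
(* The cap 1 keeps [1 - eps n] nonnegative; where it is attained, D has no edges. *)
exists (fun n => Num.min 1 (25 / Num.sqrt n%:R)); split=> [n|].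
  by rewrite le_min ler01 divr_ge0 // sqrtr_ge0.
split=> [|n D]; first exact: cvg_const_div_sqrt.
set m := num_edges _; set d := max_degree D; set q : R := Num.sqrt n%:R.
have [n0|n0] := posnP n.
  move=> _; apply: realizable_edgeless; move: D {m d q}; rewrite n0 => D.
  by rewrite /max_degree big1 // => -[] [].
have [le1|gt1] := lerP 1 (25 / q).
  rewrite subrr mul0r -[0]/(0%:R) ler_nat leqn0 => /eqP; exact: realizable_edgeless.
have nR : 0 < n%:R :> R by rewrite ltr0n.
have q0 : 0 < q by rewrite sqrtr_gt0.
have qq : q * q = n%:R by rewrite -expr2 sqr_sqrtr // ler0n.
have q25 : 25 < q by move: gt1; rewrite ltr_pdivrMr // mul1r.
(* Since s > 3 sqrt n, its square exceeds 8n, and rounding costs at most 1. *)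
pose s := (Num.truncn (3 * q)).+1.
have s_gt : 3 * q < s%:R by exact: truncnS_gt.
have s_le : s%:R <= 3 * q + 1.
  by rewrite /s -natr1 lerD2r truncn_le // mulr_ge0 // ltW.
have mnd : m%:R <= n%:R * d%:R :> R by rewrite -natrM ler_nat num_cross_le.
move=> hyp; apply: (@realizable_of_bound n D s n0).
  by rewrite -(ler_nat R) !natrM -qq; nra.
pose x : R := m%:R / n%:R; pose e := 25 / q.
have mx : m%:R = x * n%:R by rewrite divfK // gt_eqF.
have xd : x <= d%:R by rewrite ler_pdivrMr // mulrC.
have eq25 : e * q = 25 by rewrite divfK // gt_eqF.
have e0 : 0 < e by rewrite divr_gt0.
have e1 : 0 < 1 - e by rewrite subr_gt0.
rewrite -/x -/e in hyp; set M := (X in _ * X) in hyp.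
have M0 : 0 <= M.
  by rewrite -(pmulr_rge0 _ e1); apply: le_trans hyp; exact: ler0n.
have dM : d%:R <= M.
  by apply: le_trans hyp _; rewrite ler_piMl // gerBl ltW.
(* From x <= d <= (2n - 3x) / 7. *)
have x_le : 5 * x <= n%:R by move: (le_trans xd dM); rewrite /M; lra.
(* Here 2n - 3x >= 7n/5, so the constant 25 makes the right side at least 35q, while 7s <= 21q +
   7. *)
have slack : 7 * s%:R <= e * (2 * n%:R - 3 * x).
  apply: (@le_trans _ _ (e * q * (7 / 5 * q))); first by rewrite eq25; lra.
  by rewrite -mulrA ler_pM2l // mulrCA qq; lra.
have key : 7 * d%:R + 3 * x + 7 * s%:R <= 2 * n%:R.
  by move: hyp slack; rewrite /M mulrBl mul1r; lra.
rewrite -(ler_nat R) !natrD !natrM mx.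
have := ler_wpM2l (ltW nR) key; lra.
Qed.
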